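(* Let $\mathcal{A}=\mathsf{ISP}(\mathbf{M}_1)$, where $\mathbf{M}_1$ is a finite algebra, with associated topological prevariety $\mathcal{A}_{\mathscr{T}}=\mathsf{IS}_{\mathrm c}\mathsf{P}(\mathbf{M}_1^{\mathscr{T}})$. Assume that $\mathbf{M}_1$ is a lattice, or a dualisable semigroup, group, ring, or unary algebra, or any other dualisable algebra, and assume that $\mathcal{A}_{\mathscr{T}}$ is standard. Let $\mathbf{M}_2^{\mathscr{T}}$ be a dualising alter ego of $\mathbf{M}_1$. Then (i) $b_0(\mathbf{A})=n_{\mathcal{A}}(\mathbf{A})$ for each $\mathbf{A}\in\mathcal{A}$, and hence (ii) for each $\mathbf{A}\in\mathcal{A}$, $b_0(\mathbf{A})=\mathrm{G}(\mathrm{D}(\mathbf{A})^\flat)$; that is, $b_0(\mathbf{A})$ consists of all maps $\alpha\colon\mathcal{A}(\mathbf{A},\mathbf{M}_1)\to M$ that preserve the structure on $\mathbf{M}_2$.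
   Context: A structure $\mathbf{A}=\langle A;G,H,R\rangle$ is a set $A$ with a set $G$ of finitary total operations, a set $H$ of finitary partial operations and a set $R$ of finitary relations; it is an algebra if $H=R=\varnothing$. Products are formed coordinatewise (a partial operation is defined at a tuple iff it is defined in every coordinate); a substructure is a subset closed under the operations and under the partial operations where defined, with restricted structure; homomorphisms preserve operations, relations and partial operations (where defined). All compact spaces are assumed Hausdorff. $^\flat$ forgets the topology. Let $M$ be the (finite) universe of $\mathbf{M}_1$ and $\mathscr{T}$ the discrete topology on $M$; $\mathbf{M}_i^{\mathscr{T}}$ is $\mathbf{M}_i$ with $\mathscr{T}$ added. A structure $\mathbf{M}_2=\langle M;G_2,H_2,R_2\rangle$ is compatible with $\mathbf{M}_1$ if each (partial) operation in $G_2$ ($H_2$) is a homomorphism (where defined) with respect to $\mathbf{M}_1$, and each relation in $R_2$ and the domain of each $h\in H_2$ is a substructure of the appropriate power of $\mathbf{M}_1$; then $\mathbf{M}_2^{\mathscr{T}}$ is an alter ego of $\mathbf{M}_1$. $\mathsf{ISP}(\mathbf{M}_1)$: isomorphic copies of non-empty substructures of powers of $\mathbf{M}_1$. $\mathsf{IS}_{\mathrm c}\mathsf{P}(\mathbf{M}_1^{\mathscr{T}})$: isomorphic copies of non-empty topologically closed substructures of powers of $\mathbf{M}_1^{\mathscr{T}}$. $\mathcal{X}_{\mathscr{T}}:=\mathsf{IS}^0_{\mathrm c}\mathsf{P}^+(\mathbf{M}_2^{\mathscr{T}})$: isomorphic copies of topologically closed, possibly empty, substructures of powers of $\mathbf{M}_2^{\mathscr{T}}$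 with non-empty index set. $\mathcal{X}:=\mathsf{IS}^0\mathsf{P}^+(\mathbf{M}_2)$: isomorphic copies of possibly empty substructures of powers of $\mathbf{M}_2$ with non-empty index set. Morphisms are (continuous, in the topological case) homomorphisms. Define $\mathrm{D}(\mathbf{A}):=\mathcal{A}(\mathbf{A},\mathbf{M}_1)\le(\mathbf{M}_2^{\mathscr{T}})^A$ for $\mathbf{A}\in\mathcal{A}$, $\mathrm{E}(\mathbf{X}):=\mathcal{X}_{\mathscr{T}}(\mathbf{X},\mathbf{M}_2^{\mathscr{T}})\le\mathbf{M}_1^X$ for $\mathbf{X}\in\mathcal{X}_{\mathscr{T}}$, and $\mathrm{G}(\mathbf{X}):=\mathcal{X}(\mathbf{X},\mathbf{M}_2)\le(\mathbf{M}_1^{\mathscr{T}})^X$ for $\mathbf{X}\in\mathcal{X}$. $\mathbf{M}_2^{\mathscr{T}}$ is a dualising alter ego of $\mathbf{M}_1$ (dualises $\mathbf{M}_1$) if for every $\mathbf{A}\in\mathcal{A}$ the evaluation map $\mathbf{A}\to\mathrm{E}(\mathrm{D}(\mathbf{A}))$, $a\mapsto(x\mapsto x(a))$, is an isomorphism. $\mathbf{M}_1$ is dualisable if it has a dualising alter ego; every finite lattice is dualisable. A map $\alpha\colon\mathcal{A}(\mathbf{A},\mathbf{M}_1)\to M$ preserves the structure on $\mathbf{M}_2$ if it is a homomorphism $\mathrm{D}(\mathbf{A})^\flat\to\mathbf{M}_2$. $\mathcal{A}^{\mathrm{Bt}}$ is the category of compact zero-dimensional (having a basis of clopen sets) topological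 algebras with algebraic reduct in $\mathcal{A}$, with continuous homomorphisms. $\mathcal{A}_{\mathscr{T}}$ is standard if $\mathcal{A}_{\mathscr{T}}=\mathcal{A}^{\mathrm{Bt}}$. The zero-dimensional Bohr compactification $b_0(\mathbf{A})\in\mathcal{A}^{\mathrm{Bt}}$ comes with an embedding $\iota_{\mathbf{A}}\colon\mathbf{A}\to b_0(\mathbf{A})^\flat$ with dense image and is characterised up to isomorphism by: for every $\mathbf{B}\in\mathcal{A}^{\mathrm{Bt}}$ and homomorphism $g\colon\mathbf{A}\to\mathbf{B}^\flat$ there is a unique continuous homomorphism $h\colon b_0(\mathbf{A})\to\mathbf{B}$ with $h\circ\iota_{\mathbf{A}}=g$. The natural extension $n_{\mathcal{A}}(\mathbf{A})$ is the topological closure of $e_{\mathbf{A}}(A)$ in $(\mathbf{M}_1^{\mathscr{T}})^{\mathcal{A}(\mathbf{A},\mathbf{M}_1)}$, where $e_{\mathbf{A}}(a)(x)=x(a)$. Equalities involving $b_0(\mathbf{A})$ mean isomorphism of topological algebras commuting with the canonical embeddings of $\mathbf{A}$ (evaluation, in the case of $n_{\mathcal{A}}(\mathbf{A})$ and $\mathrm{G}(\mathrm{D}(\mathbf{A})^\flat)$). *)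

(* Defs.v *)
From HB Require Import structures.
From mathcomp Require Import all_boot.
From mathcomp Require Import all_classical topology.

Set Implicit Arguments.
Unset Strict Implicit.
Unset Printing Implicit Defensive.

Local Open Scope classical_set_scope.

Record symbols := Symbols { sym :> Type; arity : sym -> nat }.

Definition nosym : symbols := Symbols (of_void nat).

Record signature := Signature { ops : symbols; pops : symbols; rels : symbols }.

(* A partial operation [h] has domain [pdom s h] and takes a proof that its
   argument lies in this domain. Carriers may be empty and arities may be 0. *)
Record str (L : signature) (A : Type) := Str {
  op : forall f : ops L, ('I_(arity f) -> A) -> A;
  pdom : forall h : pops L, set ('I_(arity h) -> A);
  pop : forall (h : pops L) (x : 'I_(arity h) -> A), @pdom h x -> A;
  rel : forall r : rels L, set ('I_(arity r) -> A) }.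
Arguments op {L A} s f x.
Arguments pdom {L A} s h x.
Arguments pop {L A} s h x d.
Arguments rel {L A} s r x.

Definition algebra (S : symbols) (A : Type) := str (Signature S nosym nosym) A.

Section structures.
Context {L : signature}.

Definition hom (A B : Type) (sA : str L A) (sB : str L B) (u : A -> B) : Prop :=
  [/\ forall (f : ops L) (x : 'I_(arity f) -> A),
        u (op sA f x) = op sB f (u \o x),
      forall (h : pops L) (x : 'I_(arity h) -> A) (d : pdom sA h x),
        exists d' : pdom sB h (u \o x), u (pop sA h x d) = pop sB h (u \o x) d' &
      forall (r : rels L) (x : 'I_(arity r) -> A),
        rel sA r x -> rel sB r (u \o x)].

Definition iso (A B : Type) (sA : str L A) (sB : str L B) (u : A -> B) : Prop :=
  hom sA sB u /\ exists v : B -> A, [/\ cancel u v, cancel v u & hom sB sA v].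

Definition tiso (A B : topologicalType) (sA : str L A) (sB : str L B)
    (u : A -> B) : Prop :=
  [/\ continuous u, hom sA sB u &
    exists v : B -> A, [/\ cancel u v, cancel v u, continuous v & hom sB sA v]].

Definition power (A : Type) (sA : str L A) (I : Type) : str L (I -> A) := {|
  op := fun f x i => op sA f (fun k => x k i);
  pdom := fun h x => forall i, pdom sA h (fun k => x k i);
  pop := fun h x d i => pop sA h (fun k => x k i) (d i);
  rel := fun r x => forall i, rel sA r (fun k => x k i) |}.

Definition substr (A : Type) (sA : str L A) (X : set A) : Prop :=
  (forall (f : ops L) (x : 'I_(arity f) -> A),
     (forall k, X (x k)) -> X (op sA f x)) /\
  (forall (h : pops L) (x : 'I_(arity h) -> A) (d : pdom sA h x),
     (forall k, X (x k)) -> X (pop sA h x d)).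

Definition sub_str (A : Type) (sA : str L A) (X : set A) (hX : substr sA X) :
    str L X := {|
  op := fun f x => SigSub (mem_set (hX.1 f (fun k => val (x k))
                                      (fun k => set_valP (x k))));
  pdom := fun h x => pdom sA h (fun k => val (x k));
  pop := fun h x d => SigSub (mem_set (hX.2 h (fun k => val (x k)) d
                                         (fun k => set_valP (x k))));
  rel := fun r x => rel sA r (fun k => val (x k)) |}.

End structures.

Section alter_egos.
Context {S : symbols} {M : Type}.

Definition compatible (M1 : algebra S M) (L : signature) (M2 : str L M) : Prop :=
  [/\ forall g : ops L, hom (power M1 'I_(arity g)) M1 (op M2 g),
      forall h : pops L,
        exists hX : substr (power M1 'I_(arity h)) (pdom M2 h),
          hom (sub_str hX) M1 (fun x => pop M2 h (val x) (set_valP x)) &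
      forall r : rels L, substr (power M1 'I_(arity r)) (rel M2 r)].

Record alter_ego (M1 : algebra S M) := AlterEgo {
  ego_sig : signature;
  ego :> str ego_sig M;
  ego_compatible : compatible M1 ego }.

End alter_egos.

Lemma pop_eq (L : signature) (A : Type) (s : str L A) (h : pops L)
    (x y : 'I_(arity h) -> A) (d : pdom s h x) (d' : pdom s h y) :
  x = y -> pop s h x d = pop s h y d'.
Proof. by move=> xy; subst y; rewrite (Prop_irrelevance d d'). Qed.

Lemma hom_algebra (S : symbols) (A B : Type) (sA : algebra S A)
    (sB : algebra S B) (u : A -> B) :
  (forall f x, u (op sA f x) = op sB f (u \o x)) -> hom sA sB u.
Proof. by move=> ?; split => // -[]. Qed.

Lemma substr_algebra (S : symbols) (A : Type) (sA : algebra S A) (X : set A) :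
  (forall f x, (forall k, X (x k)) -> X (op sA f x)) -> substr sA X.
Proof. by move=> ?; split => // -[]. Qed.

Section dual.
Context {S : symbols} {M : discreteTopologicalType} {M1 : algebra S M}.

Definition D (A : Type) (sA : algebra S A) : set {ptws A -> M} :=
  [set u | hom sA M1 u].

Variable M2 : alter_ego M1.

Lemma D_substr (A : Type) (sA : algebra S A) : substr (power M2 A) (D sA).
Proof.
have [cop cpop _] := ego_compatible M2.
split=> [g x hx|h x d hx]; apply: hom_algebra => f y /=.
- have [+ _ _] := cop g => /(_ f (fun j k => x k (y j))) /= <-.
  congr (op M2 g _); apply/funext => k; have [-> _ _] := hx k.
  by congr (op M1 f _).
- have [hX [+ _ _]] := cpop h.
  move=> /(_ f (fun j => SigSub (mem_set (d (y j) : pdom M2 h _)))) /=.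
  move=> H; apply: etrans (etrans H _).
    apply: pop_eq; apply/funext => k; have [-> _ _] := hx k.
    by congr (op M1 f _).
  by congr (op M1 f _); apply/funext => j /=; exact: pop_eq.
Qed.

Definition D_str (A : Type) (sA : algebra S A) : str (ego_sig M2) (D sA) :=
  sub_str (D_substr sA).

Lemma hom_pointwise (X : Type) (sX : str (ego_sig M2) X) (f : S)
    (x : 'I_(arity f) -> X -> M) :
  (forall k, hom sX M2 (x k)) -> hom sX M2 (op (power M1 X) f x).
Proof.
have [cop cpop crel] := ego_compatible M2 => hx.
split=> [g y|h y d|r y ry] /=.
- have [+ _ _] := cop g => /(_ f (fun k j => x k (y j))) /= E.
  apply: etrans (esym E); congr (op M1 f _); apply/funext => k.
  by have [-> _ _] := hx k.
- have [hX [+ _ _]] := cpop h.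
  have dx k : pdom M2 h (x k \o y) by have [_ /(_ h y d)[]] := hx k.
  move=> /(_ f (fun k => SigSub (mem_set (dx k)))) /= E.
  exists (hX.1 f (fun k => x k \o y) dx).
  apply: etrans (etrans (esym E) _); last exact: pop_eq.
  congr (op M1 f _); apply/funext => k /=.
  by have [_ /(_ h y d)[d' ->] _] := hx k; exact: pop_eq.
- refine ((crel r).1 f (fun k => x k \o y) _) => k.
  by have [_ _ /(_ r y ry)] := hx k.
Qed.

Definition E (X : topologicalType) (sX : str (ego_sig M2) X) : set (X -> M) :=
  [set u | continuous u /\ hom sX M2 u].

Lemma E_substr (X : topologicalType) (sX : str (ego_sig M2) X) :
  substr (power M1 X) (E sX).
Proof.
apply: substr_algebra => f x hx; split; last first.
  by apply: hom_pointwise => k; exact: (hx k).2.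
move=> p; apply/discrete_cvg => /=.
have : \forall q \near p, forall k, x k q = x k p.
  apply: filter_forall => k.
  exact: (hx k).1 p [set x k p] (discrete_set1 _).
apply: filterS => q /= xq; congr (op M1 f _).
by apply/funext => k; rewrite xq.
Qed.

Definition E_str (X : topologicalType) (sX : str (ego_sig M2) X) :
    algebra S (E sX) :=
  sub_str (E_substr sX).

Definition G (X : Type) (sX : str (ego_sig M2) X) : set {ptws X -> M} :=
  [set u | hom sX M2 u].

Lemma G_substr (X : Type) (sX : str (ego_sig M2) X) :
  substr (power M1 X) (G sX).
Proof. by apply: substr_algebra => f x hx; exact: hom_pointwise. Qed.

Definition G_str (X : Type) (sX : str (ego_sig M2) X) : algebra S (G sX) :=
  sub_str (G_substr sX).

End dual.
Arguments D {S M} M1 {A} sA.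

Section pointwise_topology.
Context {I : Type} {T : topologicalType}.

Lemma ptws_cvgP (F : set_system {ptws I -> T}) (y : {ptws I -> T}) :
  Filter F -> F --> y <-> forall i, (fun z : {ptws I -> T} => z i) @ F --> y i.
Proof.
move=> FF; split=> [/cvg_sup Fy i U yU|Fy].
  have H := @initial_continuous _ _ (fun z : I -> T => z i) y U yU.
  apply: (Fy i); exact H.
apply/cvg_sup => i U /=; rewrite (@nbhsE (initial_topology _)).
case=> _ [[C oC <-] Cy] CU; apply: filterS CU _.
by apply: (Fy i C); apply: open_nbhs_nbhs.
Qed.

Lemma ptws_proj_continuous i : continuous (fun z : {ptws I -> T} => z i).
Proof.
move=> y; have [/(_ cvg_id) H _] := @ptws_cvgP (nbhs y) y _.
exact: H i.
Qed.


Definition agree (s : seq I) (y z : I -> T) : Prop :=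
  foldr (fun i P => z i = y i /\ P) True s.

Lemma agree_cat (s t : seq I) (y z : I -> T) :
  agree (s ++ t) y z <-> agree s y z /\ agree t y z.
Proof. by elim: s => /= [|i s IH]; [tauto|rewrite IH; tauto]. Qed.

Hypothesis discT : forall a : T, nbhs a [set a].

Lemma agree_near (s : seq I) (y : {ptws I -> T}) : nbhs y (agree s y).
Proof.
elim: s => [|i s IH]; last first.
  have yi := @ptws_proj_continuous i y _ (discT (y i)).
  exact: (@filterI _ _ (nbhs_filter y) _ _ yi IH).
have H := @filterS _ _ (nbhs_filter y) setT (agree [::] y).
by refine (H _ _); [by []|exact filterT].
Qed.

Lemma closure_ptwsP (X : set {ptws I -> T}) (y : {ptws I -> T}) :
  closure X y <-> forall s : seq I, exists2 x, X x & agree s y x.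
Proof.
split=> [Xy s|H U yU].
  by have [x [Xx sx]] := Xy _ (agree_near s y); exists x.
pose F := filter_from [set: seq I] (fun s => agree s y : set {ptws I -> T}).
have FF : Filter F.
  apply: filter_from_filter; first by exists [::].
  by move=> s t _ _; exists (s ++ t) => // z /agree_cat.
have /(_ U yU)[s _ sU] : F --> y.
  apply/ptws_cvgP => i V /nbhs_singleton yV; exists [:: i] => // z.
  by rewrite /agree /= => -[->].
by have [x Xx /sU Ux] := H s; exists x.
Qed.

End pointwise_topology.

Lemma closure_substr (S : symbols) (I : Type) (M : discreteTopologicalType)
    (M1 : algebra S M) (X : set {ptws I -> M}) :
  substr (power M1 I) X -> substr (power M1 I) (closure X).
Proof.
move=> [cX _]; apply: substr_algebra => f y hy; 
have discM : forall a : M, nbhs a [set a] by exact: discrete_set1.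
apply/(closure_ptwsP discM) => s.
have /choice[x hx] k : exists x, X x /\ agree s (y k) x.
  by have /(closure_ptwsP discM)/(_ s)[x ? ?] := hy k; exists x.
exists (op (power M1 I) f x); first by apply: cX => k; exact: (hx k).1.
have {hx} : forall k, agree s (y k) (x k) by move=> k; exact: (hx k).2.
elim: s => //= i s IH H; split; last by apply: IH => k; exact: (H k).2.
by congr (op M1 f _); apply/funext => k; exact: (H k).1.
Qed.

Section evaluation.
Context {S : symbols} {M : discreteTopologicalType} {M1 : algebra S M}.

Section algebra.
Context {A : Type} (sA : algebra S A).

Definition ev (a : A) : {ptws D M1 sA -> M} := fun x => val x a.

Lemma ev_hom : hom sA (power M1 (D M1 sA)) ev.
Proof.
apply: hom_algebra => f x; apply/funext => u.
by have [/(_ f x) H _ _] := set_valP u; exact: H.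
Qed.

Lemma ev_continuous (a : A) : continuous (ev a : D M1 sA -> M).
Proof.
move=> x U xU.
have H := @ptws_proj_continuous A M a (val x) U xU.
have H' := @initial_continuous _ _ (set_val : D M1 sA -> _) x _ H.
exact H'.
Qed.

Lemma ev_dual_hom (M2 : alter_ego M1) (a : A) : hom (D_str M2 sA) M2 (ev a).
Proof. by split=> [//|h x d|r x rx]; [exists (d a)|exact: rx a]. Qed.

Lemma ev_range_substr : substr (power M1 (D M1 sA)) (range ev).
Proof.
apply: substr_algebra => f x hx.
have /choice[a ha] k : exists a, ev a = x k.
  by have [a _ <-] := hx k; exists a.
exists (op sA f a) => //; have [-> _ _] := ev_hom.
by congr (op _ f _); apply/funext => k /=.
Qed.

Definition nat_ext : set {ptws D M1 sA -> M} := closure (range ev).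

Definition nat_ext_str : algebra S nat_ext :=
  sub_str (closure_substr ev_range_substr).

Definition nat_ext_ev (a : A) : nat_ext :=
  SigSub (mem_set (@subset_closure _ (range ev) (ev a) (imageT ev a))).

Variable M2 : alter_ego M1.

Definition E_ev (a : A) : E (D_str M2 sA) :=
  SigSub (mem_set (conj (@ev_continuous a) (ev_dual_hom M2 a))).

Definition G_ev (a : A) : G (D_str M2 sA) :=
  SigSub (mem_set (ev_dual_hom M2 a)).

End algebra.

Definition ISP (A : Type) (sA : algebra S A) : Prop :=
  exists (I : Type) (X : set (I -> M)) (hX : substr (power M1 I) X),
    X !=set0 /\ exists u : A -> X, iso sA (sub_str hX) u.

Definition IScP (T : topologicalType) (sT : algebra S T) : Prop :=
  exists (I : Type) (X : set {ptws I -> M}) (hX : substr (power M1 I) X),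
    [/\ X !=set0, closed X & exists u : T -> X, tiso sT (sub_str hX : algebra S X) u].

(* The library predicate [zero_dimensional] only asks that clopen sets separate
   points; here the clopen sets form a basis. *)
Definition Bt (T : topologicalType) (sT : algebra S T) : Prop :=
  [/\ forall f : S, continuous (op sT f : {ptws 'I_(arity f) -> T} -> T),
      compact [set: T], hausdorff_space T, basis (@clopen T) &
      ISP sT].

Definition standard : Prop :=
  forall (T : topologicalType) (sT : algebra S T), IScP sT <-> Bt sT.

Definition dualises (M2 : alter_ego M1) : Prop :=
  forall (A : Type) (sA : algebra S A), ISP sA ->
    iso sA (E_str (D_str M2 sA)) (E_ev sA M2).

Definition dualisable : Prop := exists M2 : alter_ego M1, dualises M2.

Definition is_b0 (A : Type) (sA : algebra S A)
    (B : topologicalType) (sB : algebra S B) (iota : A -> B) : Prop :=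
  [/\ Bt sB, hom sA sB iota /\ injective iota, dense (range iota) &
    forall (C : topologicalType) (sC : algebra S C), Bt sC ->
      forall g : A -> C, hom sA sC g ->
        exists! h : B -> C,
          [/\ continuous h, hom sB sC h & forall a, h (iota a) = g a]].

(* [b0(A) = T], where [A] is canonically embedded in [T] by [e]: [b0(A)] exists,
   and each of its realisations is isomorphic to [T] over [A]. *)
Definition b0_eq (A : Type) (sA : algebra S A)
    (T : topologicalType) (sT : algebra S T) (e : A -> T) : Prop :=
  (exists (B : topologicalType) (sB : algebra S B) (iota : A -> B),
     is_b0 sA sB iota) /\
  (forall (B : topologicalType) (sB : algebra S B) (iota : A -> B),
     is_b0 sA sB iota ->
     exists u : B -> T, tiso sB sT u /\ forall a, u (iota a) = e a).

End evaluation.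
Arguments ISP {S M} M1 {A} sA.
Arguments IScP {S M} M1 {T} sT.
Arguments Bt {S M} M1 {T} sT.
Arguments standard {S M} M1.
Arguments dualisable {S M} M1.
Arguments b0_eq {S M} M1 {A} sA {T} sT e.
Arguments nat_ext_str {S M} M1 {A} sA.
Arguments nat_ext_ev {S M} M1 {A} sA a.

(* Main.v *)
(* The closure of e_A(A) in a power of M1 lies in IScP(M1) = A^Bt, and it has
   the universal property of b_0(A): if C is a closed substructure of M1^I and
   g : A -> C is a homomorphism, each coordinate of g is a point of D(A), so g
   extends to the closure by reindexing coordinates.

   For (ii), let alpha preserve the structure on M2 and let x_1, ..., x_n be in
   D(A). The image B of A in M1^n under q = (x_1, ..., x_n) is finite, so every
   map on D(B) is continuous. Composing alpha with D(q) : D(B) -> D(A) gives an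
   element of E(D(B)), which by duality is evaluation at some q(a) in B. At the
   projections of B this says alpha(x_i) = x_i(a), so alpha is in the closure of
   e_A(A). *)
Require Import Defs.
From mathcomp Require Import all_boot.
From mathcomp Require Import all_classical topology.

Set Implicit Arguments.
Unset Strict Implicit.
Unset Printing Implicit Defensive.

Local Open Scope classical_set_scope.

(** * Continuity into subspaces and pointwise powers, and finiteness of finite powers *)

Lemma continuous_set_val (T : topologicalType) (X : set T) :
  continuous (set_val : X -> T).
Proof. exact: (@initial_continuous X T set_val). Qed.

Lemma continuous_to_sub (U T : topologicalType) (X : set T) (f : U -> X) :
  continuous (set_val \o f) -> continuous f.
Proof. exact: (@continuous_comp_initial X U T set_val f). Qed.

Lemma continuous_to_ptws (U T : topologicalType) (I : Type)
    (f : U -> {ptws I -> T}) :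
  (forall i, continuous (fun t => f t i)) -> continuous f.
Proof.
move=> cf t; have H := @ptws_cvgP I T (f @ t) (f t) _.
by apply/H => i; exact: cf i t.
Qed.

(** If the values at some [t] differed, their disjoint neighbourhoods would pull back to a non-empty
    open set, and a point of [X] in it would give a contradiction. *)
Lemma continuous_dense_eq (U T : topologicalType) (X : set U) (f g : U -> T) :
  hausdorff_space T -> dense X -> continuous f -> continuous g ->
  (forall x, X x -> f x = g x) -> f = g.
Proof.
rewrite open_hausdorff => hT dX cf cg fg; apply/funext => t.
apply/eqP; apply: contrapT => /negP /hT [[V W] /= []].
rewrite !inE => Vf Wg [oV oW VW].
have oO : open (f @^-1` V `&` g @^-1` W).
  by apply: openI; [move/continuousP: cf; exact|move/continuousP: cg; exact].
have [x [[/= Vx Wx] Xx]] := dX _ (ex_intro _ t (conj Vf Wg)) oO.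
by have : set0 (f x) by rewrite -VW; split=> //; rewrite fg.
Qed.

Lemma agreeP (I : eqType) (T : topologicalType) (s : seq I) (y z : I -> T) :
  agree s y z <-> forall i, i \in s -> z i = y i.
Proof.
elim: s => [|j s IH] /=; first by split.
rewrite IH; split=> [[zj zs] i|zs].
  by rewrite inE => /predU1P[->|/zs].
split=> [|i si]; first by apply: zs; rewrite mem_head.
by apply: zs; rewrite inE si orbT.
Qed.

Lemma finite_set_pow (T : choiceType) (n : nat) :
  finite_set [set: T] -> finite_set [set: 'I_n -> T].
Proof.
move=> /finite_seqP[s Ts].
have sT (t : T) : t \in s by have : [set` s] t by rewrite -Ts.
have := finite_image (fun (g : {ffun 'I_n -> seq_sub s}) k => val (g k))
  (@finite_finset _ setT).
apply: sub_finite_set => x _.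
exists [ffun k => SeqSub (sT (x k))] => //.
by apply/funext => k; rewrite ffunE.
Qed.

(** * Homomorphisms into powers and substructures *)

Section homomorphisms.
Context {L : signature}.

Lemma hom_comp (A B C : Type) (sA : str L A) (sB : str L B) (sC : str L C)
    (u : A -> B) (v : B -> C) :
  hom sA sB u -> hom sB sC v -> hom sA sC (v \o u).
Proof.
move=> [uo up ur] [vo vp vr]; split=> [f x|h x d|r x rx] /=.
- by rewrite uo vo.
- by have [d' ->] := up h x d; exact: vp.
- exact/vr/ur.
Qed.

Lemma hom_id (A : Type) (sA : str L A) : hom sA sA id.
Proof. by split=> // h x d; exists d. Qed.

Lemma hom_proj (A I : Type) (sA : str L A) (i : I) :
  hom (power sA I) sA (fun x => x i).
Proof. by split=> [//|h x d|r x rx]; [exists (d i)|exact: rx i]. Qed.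

Lemma hom_val (A : Type) (sA : str L A) (X : set A) (hX : substr sA X) :
  hom (sub_str hX) sA set_val.
Proof. by split=> // h x d; exists d. Qed.

Lemma hom_to_sub (A B : Type) (sA : str L A) (sB : str L B) (X : set B)
    (hX : substr sB X) (u : A -> X) :
  hom sA sB (set_val \o u) -> hom sA (sub_str hX) u.
Proof.
move=> [uo up ur]; split=> [f x|h x d|r x rx].
- exact/val_inj/(uo f x).
- by have [d' E] := up h x d; exists d'; apply: val_inj; exact: E.
- exact: ur r x rx.
Qed.

(* Arities are finite, so each homomorphism condition involves only finitely
   many coordinates. *)
Lemma closed_hom (M : discreteTopologicalType) (X : eqType) (sX : str L X)
    (sM : str L M) : closed [set u : {ptws X -> M} | hom sX sM u].
Proof.
move=> u /(closure_ptwsP (@discrete_set1 M)) cu.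
(* Agreement on a list that contains [codom x] fixes all arguments at once; the rest [s] is left for
   the point where the result is read off. *)
have cod (I : finType) (x : I -> X) (v : X -> M) s :
    agree (codom x ++ s) u v -> v \o x = u \o x.
  move=> /agree_cat[/agreeP H _]; apply/funext => k /=.
  by apply: H; exact: codom_f.
split=> [f x|h x d|r x rx].
- have [v [vo _ _] uv] := cu (codom x ++ [:: op sX f x]).
  have := uv; rewrite agree_cat => -[_ /= [<- _]].
  by rewrite vo (cod _ _ _ _ uv).
- have [v [_ vp _] uv] := cu (codom x ++ [:: pop sX h x d]).
  have vx := cod _ _ _ _ uv; have [d'] := vp h x d.
  have := uv; rewrite agree_cat => -[_ /= [-> _]] ->.
  rewrite vx in d' *; by exists d'.
- have [v [_ _ vr] uv] := cu (codom x ++ [::]).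
  by rewrite -(cod _ _ _ _ uv); exact: vr.
Qed.

End homomorphisms.

Lemma hom_to_power (S : symbols) (A B I : Type) (sA : algebra S A)
    (sB : algebra S B) (u : A -> I -> B) :
  (forall i, hom sA sB (fun a => u a i)) -> hom sA (power sB I) u.
Proof.
move=> hu; apply: hom_algebra => f x; apply/funext => i.
by have [H _ _] := hu i; exact: H f x.
Qed.

Lemma hom_range_substr (S : symbols) (A B : Type) (sA : algebra S A)
    (sB : algebra S B) (u : A -> B) : hom sA sB u -> substr sB (range u).
Proof.
move=> [hu _ _]; apply: substr_algebra => f x hx.
have /choice[a ha] k : exists a, u a = x k by have [a _ <-] := hx k; exists a.
by exists (op sA f a) => //; rewrite hu; congr op; apply/funext.
Qed.

Local Notation eval sA := (ev (sA := sA)).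

(** * The universal property of the closure of the evaluations *)

Section bohr.
Context {S : symbols} {M : discreteTopologicalType} {M1 : algebra S M}.

Lemma ISP_sub (I : Type) (X : set (I -> M)) (hX : substr (power M1 I) X) :
  X !=set0 -> ISP M1 (sub_str hX).
Proof.
move=> X0; exists I, X, hX; split=> //; exists id; split; first exact: hom_id.
by exists id; split=> //; exact: hom_id.
Qed.

Lemma IScP_sub (I : Type) (X : set {ptws I -> M}) (hX : substr (power M1 I) X) :
  X !=set0 -> closed X -> IScP M1 (sub_str hX : algebra S X).
Proof.
move=> X0 cX; exists I, X, hX; split=> //; exists id.
split; [by move=> ?; exact: cvg_id|exact: hom_id|].
by exists id; split=> //; [move=> ?; exact: cvg_id|exact: hom_id].
Qed.

Section algebra.
Context {A : Type} {sA : algebra S A}.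
Hypothesis hA : ISP M1 sA.

Lemma ISP_inhabited : inhabited A.
Proof.
have [I [X [hX [[x Xx] [u [_ [v _]]]]]]] := hA.
by split; exact: v (SigSub (mem_set Xx)).
Qed.

(** An embedding of [A] into a power of [M1] has its coordinates in [D M1 sA], and these already
    separate points. *)
Lemma ev_inj : injective (eval sA : A -> {ptws D M1 sA -> M}).
Proof.
have [I [X [hX [_ [u [hu [v [uv _ _]]]]]]]] := hA => a b ab.
apply: (can_inj uv); apply: val_inj; apply/funext => i.
have hi : D M1 sA (fun a => val (u a) i).
  exact: hom_comp (hom_comp hu (hom_val hX)) (hom_proj M1 i).
exact: (congr1 (fun y => y (SigSub (mem_set hi))) ab).
Qed.

(** Universal objects are unique: the comparison maps in both directions compose to maps that fix
    the image of [A], as the identity does, so uniqueness of extensions makes them inverse. *)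
Lemma b0_eq_is_b0 (T : topologicalType) (sT : algebra S T) (e : A -> T) :
  is_b0 (M1 := M1) sA sT e -> b0_eq M1 sA sT e.
Proof.
move=> bT; split=> [|B sB iota bB]; first by exists T, sT, e.
have [BtT [he _] _ uT] := bT.
have [BtB [hi _] _ uB] := bB.
have [u [[cu hu ui] _]] := uB T sT BtT e he.
have [v [[cv hv ve] _]] := uT B sB BtB iota hi.
have vu : v \o u = id.
  have [w [_ wP]] := uB B sB BtB iota hi.
  transitivity w; first apply/esym; apply: wP; last first.
    by split=> [x|//|//]; [exact: cvg_id|exact: hom_id].
  split=> [x||a /=]; [|exact: hom_comp hu hv|by rewrite ui ve].
  exact: continuous_comp (cu x) (cv _).
have uv : u \o v = id.
  have [w [_ wP]] := uT T sT BtT e he.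
  transitivity w; first apply/esym; apply: wP; last first.
    by split=> [x|//|//]; [exact: cvg_id|exact: hom_id].
  split=> [x||a /=]; [|exact: hom_comp hv hu|by rewrite ve ui].
  exact: continuous_comp (cv x) (cu _).
exists u; split=> //; split=> //; exists v; split=> // x.
- by rewrite -[LHS]/((v \o u) x) vu.
- by rewrite -[LHS]/((u \o v) x) uv.
Qed.

(** The carrier [X] is a variable, equal to the closure only by a hypothesis, so that both [nat_ext]
    and [G] can take its place without transport between subtypes. *)
Lemma is_b0_closure_ev (A_standard : standard M1)
    (X : set {ptws D M1 sA -> M}) (hX : substr (power M1 (D M1 sA)) X)
    (e : A -> X) :
  X = closure (range (eval sA)) -> (forall a, set_val (e a) = eval sA a) ->
  is_b0 (M1 := M1) sA (sub_str hX : algebra S X) e.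
Proof.
move=> XE he.
have clX (y : X) : closure (range (eval sA)) (set_val y).
  by have : X `<=` closure (range (eval sA)); [rewrite XE|apply; exact: set_valP].
have hom_e : hom sA (sub_str hX) e.
  apply: hom_to_sub; rewrite (_ : set_val \o e = eval sA); first exact: ev_hom.
  exact/funext.
have dense_e : dense (range e).
  move=> O [y +] [U oU OU]; rewrite -{}OU => Uy.
  have := @clX y U (open_nbhs_nbhs (conj oU Uy)).
  case=> [_ [[a _ <-] Ua]].
  by exists (e a); split; [rewrite /= he|exists a].
split=> //.
- apply/A_standard; apply: IScP_sub.
    by have [a] := ISP_inhabited; exists (set_val (e a)); exact: set_valP.
  by rewrite XE; exact: closed_closure.
- by split=> // a b ab; apply: ev_inj; rewrite -!he ab.
move=> C sC BtC g hg.
have [_ _ hC _ _] := BtC.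
(* Standardness, used here from [Bt] to [IScP], turns [C] into a closed substructure [Y] of a power
   of [M1]. *)
have /A_standard[I [Y [hY [_ cY [u [cu hu [v [uv vu cv hv]]]]]]]] := BtC.
have hi i : D M1 sA (fun a => set_val (u (g a)) i).
  exact: hom_comp (hom_comp (hom_comp hg hu) (hom_val hY)) (hom_proj M1 i).
pose Phi (y : {ptws D M1 sA -> M}) : {ptws I -> M} :=
  fun i => y (SigSub (mem_set (hi i))).
have cPhi : continuous Phi.
  by apply: continuous_to_ptws => i; exact: ptws_proj_continuous.
have Phi_ev a : Phi (eval sA a) = set_val (u (g a)) by [].
(* [Phi] sends evaluations into [Y]; by continuity it sends their closure into the closed set
   [Y]. *)
have PhiX (y : X) : Y (Phi (set_val y)).
  apply: cY => V /cPhi /clX[_ [[a _ <-] Va]].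
  by exists (Phi (eval sA a)); split=> //; rewrite Phi_ev; exact: set_valP.
pose w (y : X) : Y := SigSub (mem_set (PhiX y)).
have cw : continuous w.
  apply: continuous_to_sub => y.
  exact: (@continuous_comp _ _ _ set_val Phi y (@continuous_set_val _ X y)
    (cPhi _)).
have hw : hom (sub_str hX) (sub_str hY) w.
  apply: hom_to_sub; apply: hom_to_power => i.
  exact: hom_comp (hom_val hX) (hom_proj M1 _).
have cvw : continuous (v \o w) by move=> y; exact: continuous_comp (cw y) (cv _).
have vw_e a : v (w (e a)) = g a.
  rewrite -[RHS]uv; congr v; apply: val_inj.
  by apply: etrans (Phi_ev a); rewrite -he.
exists (v \o w); split; first by split=> //; exact: hom_comp hw hv.
move=> h [ch _ hh]; apply: (continuous_dense_eq hC dense_e) => //.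
by move=> _ [a _ <-] /=; rewrite hh vw_e.
Qed.

End algebra.

(** * Duality on finite quotients and the maps that preserve the structure on [M2] *)

Lemma continuous_finite_dual (B : choiceType) (sB : algebra S B)
    (phi : D M1 sB -> M) : finite_set [set: B] -> continuous phi.
Proof.
move=> /finite_seqP[t Bt] p.
have Fp : Filter (nbhs p) := nbhs_filter (p : D M1 sB).
apply/discrete_cvg.
(* Agreement on the finite list [t] of all elements of [B] is an open condition that isolates [p],
   so the dual is discrete. *)
have : \forall q \near p, agree t (set_val p) (set_val q).
  exact: (@continuous_set_val _ (D M1 sB) p _
    (@agree_near B M (@discrete_set1 M) t (set_val p))).
apply: filterS => q /agreeP pq; congr phi; apply: val_inj; apply/funext => b.
by apply: pq; have : [set` t] b by rewrite -Bt.
Qed.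

(** This is the action of the functor D on the morphism [q], with the topology forgotten. *)
Lemma dual_hom_comp (M2 : alter_ego M1) (A B : Type) (sA : algebra S A)
    (sB : algebra S B) (q : A -> B) (hq : hom sA sB q) :
  hom (D_str M2 sB) (D_str M2 sA)
    (fun u => SigSub (mem_set (hom_comp hq (set_valP u : D M1 sB _)))).
Proof.
apply: hom_to_sub; split=> [f x|h x d|r x rx] /=.
- by [].
- by exists (fun a => d (q a)); apply/funext.
- by move=> a; exact: rx (q a).
Qed.

Lemma G_dual_closure_ev (M2 : alter_ego M1) (A : Type) (sA : algebra S A) :
  finite_set [set: M] -> dualises M2 -> ISP M1 sA ->
  G (D_str M2 sA) = closure (range (eval sA)).
Proof.
move=> Mfin M2d hA; apply/seteqP; split; last first.
  (* The easy inclusion: [G] is closed and contains every evaluation. *)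
  rewrite (closure_id (G (D_str M2 sA))).1; last exact: closed_hom.
  by apply: closureS => _ [a _ <-]; exact: ev_dual_hom.
move=> alpha halpha; apply/(closure_ptwsP (@discrete_set1 M)) => s.
pose x := tnth (in_tuple s).
pose q0 (a : A) : 'I_(size s) -> M := fun k => set_val (x k) a.
have hq0 : hom sA (power M1 'I_(size s)) q0.
  by apply: hom_to_power => k; exact: set_valP (x k).
pose hB := hom_range_substr hq0.
pose q (a : A) : range q0 := SigSub (mem_set (imageT q0 a)).
have hq : hom sA (sub_str hB) q by exact: hom_to_sub.
have ISPB : ISP M1 (sub_str hB).
  by apply: ISP_sub; have [a] := ISP_inhabited hA; exists (q0 a), a.
have Bfin : finite_set [set: range q0].
  rewrite (_ : setT = set_val @^-1` [set: 'I_(size s) -> M]) //.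
  by apply: finite_preimage; [move=> ? ? _ _; exact: val_inj|exact: finite_set_pow].
(* Duality for the finite image of [q0]: [v] returns the element at which a given member of the
   bidual evaluates. *)
have [_ [v [_ vK _]]] := M2d _ _ ISPB.
pose Dq (u : D M1 (sub_str hB)) : D M1 sA :=
  SigSub (mem_set (hom_comp hq (set_valP u : D M1 (sub_str hB) _))).
have Ealpha : E (D_str M2 (sub_str hB)) (alpha \o Dq).
  split; first exact: continuous_finite_dual.
  exact: hom_comp (dual_hom_comp M2 hq) halpha.
pose beta : E (D_str M2 (sub_str hB)) := SigSub (mem_set Ealpha).
(* [v beta] lies in the range of [q0]; any preimage [a] yields the evaluation that matches [alpha]
   on [s]. *)
have [a _ qa] := set_valP (v beta).
exists (eval sA a); first by exists a.
apply/agreeP => y /(@tnthP _ _ (in_tuple s)) [k ->].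
have hk : D M1 (sub_str hB) (fun b => set_val b k).
  exact: hom_comp (hom_val hB) (hom_proj M1 k).
have := congr1 (fun b : E (D_str M2 (sub_str hB)) =>
  set_val b (SigSub (mem_set hk))) (vK beta).
move=> Ek; apply: etrans (etrans Ek _); first exact: (congr1 (fun b => b k) qa).
(* Pulling the projection [hk] back along [q] gives [x k], the entry of [s] under consideration. *)
by congr alpha; exact: val_inj.
Qed.

End bohr.

Theorem theorem5p3 (S : symbols) (M : discreteTopologicalType)
    (M_finite : finite_set [set: M]) (M1 : algebra S M)
    (M1_dualisable : dualisable M1) (A_standard : standard M1)
    (M2 : alter_ego M1) (M2_dualises : dualises M2) :
  (forall (A : Type) (sA : algebra S A), ISP M1 sA ->
     b0_eq M1 sA (nat_ext_str M1 sA) (nat_ext_ev M1 sA)) /\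
  (forall (A : Type) (sA : algebra S A), ISP M1 sA ->
     b0_eq M1 sA (G_str (D_str M2 sA)) (G_ev sA M2)).
Proof.
(* The carrier of [nat_ext] is the closure by definition; for [G] the equality of sets remains and
   comes from duality. *)
split=> A sA hA; apply: b0_eq_is_b0; apply: is_b0_closure_ev => //.
exact: G_dual_closure_ev.
Qed.
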